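(* Let $1,2,3,4$ be distinct vertices and let $s$ be a graph with no edge containing the vertex $1$. Then $$s\wedge 123\wedge 124\wedge 134\;\sim\;(s\wedge 23)\,\cup\,(s\wedge 24)\,\cup\,(s\wedge 34),$$ where $ijk$ and $ij$ denote the edges $\{i,j,k\}$ and $\{i,j\}$ (each of multiplicity one).
   Context: Each vertex $v$ is also a boolean variable. A clause is a disjunction of literals; a Cnf is a conjunction of one or more clauses, viewed as a set of clauses; a Cnf is satisfiable if some truth assignment makes it true. An edge is a nonempty set of vertices; a graph is a nonempty multiset of edges, written $(e_1)^{n_1}\cdots(e_m)^{n_m}$ with $n_i$ the multiplicity of $e_i$. The edge $v_1\cdots v_k$ supports the $2^k$ clauses $l_1\vee\cdots\vee l_k$ with $l_i\in\{v_i,\overline{v_i}\}$. The edge $e$ with multiplicity $n$ corresponds to the set of all Cnfs $c_1\wedge\cdots\wedge c_n$ with $c_1,\dots,c_n$ pairwise distinct clauses supported on $e$. A graph $(e_1)^{n_1}\cdots(e_m)^{n_m}$ is identified with the set of all Cnfs $x_1\wedge\cdots\wedge x_m$ with $x_i$ in the set corresponding to $e_i$ with multiplicity $n_i$. For sets of Cnfs, $s_1\wedge s_2=\{x_1\wedge x_2: x_1\in s_1,x_2\in s_2\}$, and $\cup$ is set union. A set of Cnfs is totally satisfiable if it is nonempty and every Cnf in it is satisfiable; otherwise it is unsatisfiable. $s_1\sim s_2$ (equi-satisfiable) means both are totally satisfiable or both are unsatisfiable. *)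

(* Defs.v *)
(* Mathematical Components, with finite sets and multisets from finmap and
   (possibly infinite) sets from classical_sets. *)
From HB Require Import structures.
From mathcomp Require Import all_boot finmap multiset.
From mathcomp Require Import classical_sets.

Set Implicit Arguments.
Unset Strict Implicit.
Unset Printing Implicit Defensive.

Local Open Scope fset_scope.

(* The literal [(v, true)] is the variable v, [(v, false)] its negation. *)
Definition literal (V : choiceType) : choiceType := (V * bool)%type.

(* A clause is the finite set of its literals, read as their disjunction. *)
Definition clause (V : choiceType) : choiceType := {fset literal V}.

(* A Cnf is the nonempty finite set of its clauses, read as their conjunction. *)
Record cnf (V : choiceType) := Cnf {
  clauses :> {fset clause V};
  clauses_neq0 : clauses != fset0
}.

Record edge (V : choiceType) := Edge {
  vertices :> {fset V};
  vertices_neq0 : vertices != fset0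
}.

HB.instance Definition _ (V : choiceType) := [isSub for @vertices V].
HB.instance Definition _ (V : choiceType) := [Choice of edge V by <:].

Record graph (V : choiceType) := Graph {
  edges :> {mset edge V}%mset;
  edges_neq0 : (edges != mset0)%mset
}.

Section Satisfiability.
Variable V : choiceType.

Definition literal_true (a : V -> bool) (l : literal V) : Prop := a l.1 = l.2.

Definition clause_true (a : V -> bool) (c : clause V) : Prop :=
  exists2 l, l \in c & literal_true a l.

Definition cnf_true (a : V -> bool) (x : cnf V) : Prop :=
  forall c, c \in clauses x -> clause_true a c.

Definition satisfiable (x : cnf V) : Prop := exists a, cnf_true a x.

Definition totally_satisfiable (s : set (cnf V)) : Prop :=
  (s !=set0)%classic /\ forall x, s x -> satisfiable x.

Definition unsatisfiable (s : set (cnf V)) : Prop := ~ totally_satisfiable s.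

Definition equisatisfiable (s1 s2 : set (cnf V)) : Prop :=
  (totally_satisfiable s1 /\ totally_satisfiable s2) \/
  (unsatisfiable s1 /\ unsatisfiable s2).

End Satisfiability.

Section Conjunction.
Variable V : choiceType.

Lemma and_cnf_subproof (x y : cnf V) : clauses x `|` clauses y != fset0.
Proof. by rewrite fsetU_eq0 negb_and clauses_neq0. Qed.

Definition and_cnf (x y : cnf V) : cnf V := Cnf (and_cnf_subproof x y).

Definition and_set (s1 s2 : set (cnf V)) : set (cnf V) :=
  [set and_cnf x y | x in s1 & y in s2]%classic.

End Conjunction.

Section Graphs.
Variable V : choiceType.

(* One literal for each vertex of e, its sign being chosen by b. *)
Definition supports (e : edge V) (c : clause V) : Prop :=
  exists b : V -> bool, c = [fset ((v, b v) : literal V) | v in vertices e].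

(* The set of Cnfs corresponding to the edge e with multiplicity n. *)
Definition edge_cnfs (e : edge V) (n : nat) : set (cnf V) :=
  [set x | #|` clauses x| = n /\
           forall c, c \in clauses x -> supports e c]%classic.

(* The set of Cnfs with which the graph g is identified; the index e of the
   union ranges over the distinct edges of g, and [edges g e] is the
   multiplicity of e. *)
Definition graph_cnfs (g : graph V) : set (cnf V) :=
  [set x | exists2 f : edge V -> cnf V,
     forall e, e \in edges g -> edge_cnfs e (edges g e) (f e) &
     clauses x = \bigcup_(e <- finsupp (edges g)) clauses (f e)]%classic.

Lemma edge2_subproof (u v : V) : [fset u; v] != fset0.
Proof. by apply/fset0Pn; exists u; rewrite !inE eqxx. Qed.

Definition edge2 (u v : V) : edge V := Edge (edge2_subproof u v).

Lemma edge3_subproof (u v w : V) : [fset u; v; w] != fset0.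
Proof. by apply/fset0Pn; exists u; rewrite !inE eqxx. Qed.

Definition edge3 (u v w : V) : edge V := Edge (edge3_subproof u v w).

Lemma graph1_subproof (e : edge V) : ([mset e] != mset0)%mset.
Proof. by apply/eqP => /msetP/(_ e); rewrite mset0E msetnxx. Qed.

Definition graph1 (e : edge V) : graph V := Graph (graph1_subproof e).

End Graphs.

Notation "s1 \wedge s2" := (and_set s1 s2) (at level 48, left associativity).
Notation "s1 \sim s2" := (equisatisfiable s1 s2) (at level 70).

(* Main.v *)
Require Import Defs.
From mathcomp Require Import all_boot finmap multiset.
From mathcomp Require Import classical_sets.
From mathcomp Require boolp.

(** Both sides are nonempty exactly when the set of Cnfs of [s] is, and they
    can be compared one Cnf [x] of [s] at a time.  Say that [x] passes an edge
    if it remains satisfiable together with any clause supported on that edge.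

    If [x], together with any choice of clauses on [123], [124] and [134], is
    satisfiable, then [x] passes [23]: resolving away first the variable 4 and
    then the variable 1 shows that a clause [c] on [23], with literals [l2] and
    [l3], follows from the three clauses
      [1 \/ l2 \/ l3],  [~1 \/ l2 \/ 4],  [~1 \/ l3 \/ ~4]
    ([resolvent]).  The other two edges are obtained by permuting 2, 3 and 4
    ([satisfiable_resolvents]).

    Conversely, let [x] pass the three edges, and take one clause on each of
    [123], [124] and [134].  Two of them contain the same literal of the
    variable 1.  Drop the variable 1 from the remaining clause, satisfy [x]
    and the shortened clause, and then reset the variable 1 so that the two
    agreeing clauses hold: [x] does not mention this variable, so it stays true
    ([satisfiable_and_edges3]). *)

Local Open Scope classical_set_scope.

Section Cnfs.
Set Implicit Arguments.
Unset Strict Implicit.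
Variable V : choiceType.
Implicit Types (a b : V -> bool) (u v w : V) (e : edge V) (x y : cnf V).

(** The signs are given by a function on all of [V], so that clauses on
    different edges can be built from one sign function by changing it at a
    vertex. *)
Definition edge_clause e b : clause V :=
  [fset ((v, b v) : literal V) | v in vertices e]%fset.

Lemma clauses_inj : injective (@clauses V).
Proof.
move=> [c c0] [d d0] /= cd; case: _ / cd d0 => d0.
by rewrite (eq_irrelevance c0 d0).
Qed.

Lemma edge_cnf_subproof e b : ([fset edge_clause e b] != fset0)%fset.
Proof. by rewrite -cardfs_gt0 cardfs1. Qed.

Definition edge_cnf e b : cnf V := Cnf (edge_cnf_subproof e b).

Lemma graph1_cnfsP e y :
  graph_cnfs (graph1 e) y <-> exists b, y = edge_cnf e b.
Proof.
have suppE : finsupp (edges (graph1 e)) = [fset e]%fset.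
  by rewrite /= finsupp_msetn.
split=> [[f f_cnfs fE]|[b ->]].
- have /f_cnfs[] : e \in edges (graph1 e).
    by rewrite /= in_mset1.
  rewrite /= msetnxx => /eqP/cardfs1P[c fc] supp_c.
  have /supp_c[b cE] : c \in clauses (f e) by rewrite fc in_fset1.
  exists b; apply: clauses_inj.
  by rewrite fE suppE big_seq_fset1 fc cE.
- exists (fun=> edge_cnf e b); last by rewrite suppE big_seq_fset1.
  move=> e'; rewrite /= in_mset1 => /eqP ->; split.
    by rewrite cardfs1 msetnxx.
  by move=> c; rewrite in_fset1 => /eqP ->; exists b.
Qed.

Lemma edge_clause_true a e b :
  clause_true a (edge_clause e b) <-> exists2 v, v \in vertices e & a v = b v.
Proof.
split=> [[_ /imfsetP[v /= ve ->] av]|[v ve av]]; first by exists v.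
by exists (v, b v) => //; apply/imfsetP; exists v.
Qed.

Lemma edge2_clause_true a u v b :
  clause_true a (edge_clause (edge2 u v) b) <-> a u = b u \/ a v = b v.
Proof.
rewrite edge_clause_true; split=> [[t]|[at_|at_]].
- by rewrite !inE => /orP[]/eqP ->; [left|right].
- by exists u; rewrite ?inE ?eqxx.
- by exists v; rewrite ?inE ?eqxx ?orbT.
Qed.

Lemma edge3_clause_true a u v w b :
  clause_true a (edge_clause (edge3 u v w) b) <->
  [\/ a u = b u, a v = b v | a w = b w].
Proof.
rewrite edge_clause_true; split=> [[t]|[at_|at_|at_]].
- by rewrite !inE => /orP[/orP[]|]/eqP ->;
    [constructor 1|constructor 2|constructor 3].
- by exists u; rewrite ?inE ?eqxx.
- by exists v; rewrite ?inE ?eqxx ?orbT.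
- by exists w; rewrite ?inE ?eqxx ?orbT.
Qed.

Lemma and_cnf_true a x y :
  cnf_true a (and_cnf x y) <-> cnf_true a x /\ cnf_true a y.
Proof.
split=> [axy|[ax ay] c]; last by rewrite in_fsetU => /orP[/ax|/ay].
by split=> c cin; apply: axy; rewrite in_fsetU cin ?orbT.
Qed.

Lemma edge_cnf_true a e b :
  cnf_true a (edge_cnf e b) <-> clause_true a (edge_clause e b).
Proof.
split=> [|ac c]; first by apply; rewrite in_fset1.
by rewrite in_fset1 => /eqP ->.
Qed.

Lemma and_graph1P (A : set (cnf V)) e y :
  (A \wedge graph_cnfs (graph1 e)) y <->
  exists2 x, A x & exists b, y = and_cnf x (edge_cnf e b).
Proof.
split=> [[x Ax [_ /graph1_cnfsP[b ->] <-]]|[x Ax [b ->]]].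
  by exists x => //; exists b.
by exists x => //; exists (edge_cnf e b) => //; apply/graph1_cnfsP; exists b.
Qed.

Lemma and_graph1_neq0 (A : set (cnf V)) e :
  (A \wedge graph_cnfs (graph1 e)) !=set0 <-> A !=set0.
Proof.
split=> [[y /and_graph1P[x Ax _]]|[x Ax]]; first by exists x.
by eexists; apply/and_graph1P; exists x => //; exists xpredT.
Qed.

(** Every literal of a Cnf in the set of [s] comes from a vertex of some edge of
    [s], hence not from [v]. *)
Lemma graph_cnf_local (s : graph V) v x a a' :
    (forall e, e \in edges s -> v \notin vertices e) ->
    (forall u, u != v -> a u = a' u) ->
  graph_cnfs s x -> cnf_true a x -> cnf_true a' x.
Proof.
move=> s_avoids_v aa' [f f_cnfs xE] ax c cx; have [l lc al] := ax c cx.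
exists l => //; rewrite /literal_true -aa' //.
move: cx; rewrite xE => /bigfcupP[e /andP[e_s _] cf].
have {}e_s : e \in edges s by rewrite -msuppE.
have [_ /(_ c cf)[b cE]] := f_cnfs e e_s.
move: lc; rewrite cE => /imfsetP[u /= ue ->] /=.
by apply: contraTneq ue => ->; apply: s_avoids_v.
Qed.

Lemma edge3_clauseAC u v w b :
  edge_clause (edge3 u v w) b = edge_clause (edge3 u w v) b.
Proof.
rewrite /edge_clause; suff -> : vertices (edge3 u v w) = edge3 u w v by [].
by rewrite /= fsetUAC.
Qed.

(** The conclusion is the resolvent on [p] of the first clause with the
    resolvent on [z] of the other two. *)
Lemma resolvent a b p u w z :
    uniq [:: p; u; w; z] ->
    clause_true a (edge_clause (edge3 p u w) [eta b with p |-> true]) ->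
    clause_true a
      (edge_clause (edge3 p u z) [eta b with p |-> false, z |-> true]) ->
    clause_true a
      (edge_clause (edge3 p w z) [eta b with p |-> false, z |-> false]) ->
  clause_true a (edge_clause (edge2 u w) b).
Proof.
rewrite /= !inE !negb_or !andbT ![p == _]eq_sym.
move=> /and3P[/and3P[up wp zp] /andP[_ uz] wz].
rewrite !edge3_clause_true edge2_clause_true /=.
rewrite !eqxx (negPf up) (negPf wp) (negPf zp) (negPf uz) (negPf wz).
(* Each hypothesis either agrees with [b] at [u] or [w], or fixes [a p] or
   [a z]; the values it fixes cannot be consistent for all three. *)
by case: (a p) (a z) => [] [] [] // ? [] // ? [] // ?; try (by left); right.
Qed.

Lemma edge3_clause_set a b p u w :
  clause_true [eta a with p |-> b p] (edge_clause (edge3 p u w) b).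
Proof. by apply/edge3_clause_true; constructor 1; rewrite /= eqxx. Qed.

(** A clause that is true without the help of [p] stays true when [p] is
    reset. *)
Lemma edge3_clause_weaken a b p u w t :
    u != p -> w != p -> clause_true a (edge_clause (edge2 u w) b) ->
  clause_true [eta a with p |-> t] (edge_clause (edge3 p u w) b).
Proof.
move=> up wp /edge2_clause_true a_uw; apply/edge3_clause_true.
rewrite /= (negPf up) (negPf wp).
by case: a_uw; [constructor 2|constructor 3].
Qed.

(** When [x] ranges over the Cnfs of [s] and [p] is the vertex to be eliminated,
    these are the elements of the left-hand side of the theorem. *)
Definition and_edges3 p u w z x b1 b2 b3 : cnf V :=
  and_cnf (and_cnf (and_cnf x (edge_cnf (edge3 p u w) b1))
                   (edge_cnf (edge3 p u z) b2))
          (edge_cnf (edge3 p w z) b3).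

Lemma and_edges3_true p u w z x b1 b2 b3 a :
  cnf_true a (and_edges3 p u w z x b1 b2 b3) <->
  [/\ cnf_true a x, clause_true a (edge_clause (edge3 p u w) b1),
      clause_true a (edge_clause (edge3 p u z) b2) &
      clause_true a (edge_clause (edge3 p w z) b3)].
Proof.
by rewrite /and_edges3 !and_cnf_true !edge_cnf_true; split=> [[[[]]]|[]].
Qed.

(** Each clause on a two-element edge is a [resolvent] of three suitable
    clauses, one on each three-element edge. *)
Lemma satisfiable_resolvents p u w z x :
    uniq [:: p; u; w; z] ->
    (forall b1 b2 b3, satisfiable (and_edges3 p u w z x b1 b2 b3)) ->
  [/\ forall b, satisfiable (and_cnf x (edge_cnf (edge2 u w) b)),
      forall b, satisfiable (and_cnf x (edge_cnf (edge2 u z) b)) &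
      forall b, satisfiable (and_cnf x (edge_cnf (edge2 w z) b))].
Proof.
move=> puwz sat.
have puzw : uniq [:: p; u; z; w].
  suff /perm_uniq -> : perm_eq [:: p; u; z; w] [:: p; u; w; z] by [].
  by rewrite !perm_cons (perm_catC [:: z] [:: w]).
have pwzu : uniq [:: p; w; z; u].
  suff /perm_uniq -> : perm_eq [:: p; w; z; u] [:: p; u; w; z] by [].
  by rewrite perm_cons (perm_catC [:: w; z] [:: u]).
split=> b.
- have [a /and_edges3_true[ax a1 a2 a3]] :=
    sat [eta b with p |-> true] [eta b with p |-> false, z |-> true]
        [eta b with p |-> false, z |-> false].
  exists a; apply/and_cnf_true; split=> //; apply/edge_cnf_true.
  exact: resolvent puwz a1 a2 a3.
- have [a /and_edges3_true[ax a1 a2 a3]] :=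
    sat [eta b with p |-> false, w |-> true] [eta b with p |-> true]
        [eta b with p |-> false, w |-> false].
  exists a; apply/and_cnf_true; split=> //; apply/edge_cnf_true.
  by apply: resolvent puzw a2 a1 _; rewrite edge3_clauseAC.
- have [a /and_edges3_true[ax a1 a2 a3]] :=
    sat [eta b with p |-> false, u |-> true]
        [eta b with p |-> false, u |-> false] [eta b with p |-> true].
  exists a; apply/and_cnf_true; split=> //; apply/edge_cnf_true.
  rewrite edge3_clauseAC in a1; rewrite edge3_clauseAC in a2.
  exact: resolvent pwzu a3 a1 a2.
Qed.

(** Two of the three signs of [p] agree: [p] is used for those two clauses, and
    a two-element edge takes care of the third. *)
Lemma satisfiable_and_edges3 (s : graph V) p u w z x :
    uniq [:: p; u; w; z] ->
    (forall e, e \in edges s -> p \notin vertices e) -> graph_cnfs s x ->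
    (forall b, satisfiable (and_cnf x (edge_cnf (edge2 u w) b))) ->
    (forall b, satisfiable (and_cnf x (edge_cnf (edge2 u z) b))) ->
    (forall b, satisfiable (and_cnf x (edge_cnf (edge2 w z) b))) ->
  forall b1 b2 b3, satisfiable (and_edges3 p u w z x b1 b2 b3).
Proof.
rewrite /= !inE !negb_or !andbT ![p == _]eq_sym.
move=> /and3P[/and3P[up wp zp] _ _].
move=> s_avoids_p sx sat_uw sat_uz sat_wz b1 b2 b3.
have set_p a t : cnf_true a x -> cnf_true [eta a with p |-> t] x.
  by apply: graph_cnf_local s_avoids_p _ sx => v /negPf /= ->.
have [b12|b12] := eqVneq (b1 p) (b2 p).
  have [a /and_cnf_true[ax /edge_cnf_true a_wz]] := sat_wz b3.
  exists [eta a with p |-> b1 p]; apply/and_edges3_true; split.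
  - exact: set_p.
  - exact: edge3_clause_set.
  - by rewrite b12; apply: edge3_clause_set.
  - exact: edge3_clause_weaken.
have [b13|b13] := eqVneq (b1 p) (b3 p).
  have [a /and_cnf_true[ax /edge_cnf_true a_uz]] := sat_uz b2.
  exists [eta a with p |-> b1 p]; apply/and_edges3_true; split.
  - exact: set_p.
  - exact: edge3_clause_set.
  - exact: edge3_clause_weaken.
  - by rewrite b13; apply: edge3_clause_set.
have b23 : b2 p = b3 p by case: (b1 p) (b2 p) (b3 p) b12 b13 => [] [] [].
have [a /and_cnf_true[ax /edge_cnf_true a_uw]] := sat_uw b1.
exists [eta a with p |-> b2 p]; apply/and_edges3_true; split.
- exact: set_p.
- exact: edge3_clause_weaken.
- exact: edge3_clause_set.
- by rewrite b23; apply: edge3_clause_set.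
Qed.

Lemma and_edges3P (A : set (cnf V)) p u w z y :
  (A \wedge graph_cnfs (graph1 (edge3 p u w))
     \wedge graph_cnfs (graph1 (edge3 p u z))
     \wedge graph_cnfs (graph1 (edge3 p w z))) y <->
  exists2 x, A x & exists b1 b2 b3, y = and_edges3 p u w z x b1 b2 b3.
Proof.
split=> [/and_graph1P[y2 /and_graph1P[y1 /and_graph1P[x Ax]]]|].
  move=> [b1 ->] [b2 ->] [b3 ->].
  by exists x => //; exists b1, b2, b3.
move=> [x Ax [b1 [b2 [b3 ->]]]].
apply/and_graph1P; eexists; last by exists b3.
apply/and_graph1P; eexists; last by exists b2.
by apply/and_graph1P; exists x => //; exists b1.
Qed.

End Cnfs.

Theorem mainTheorem6 (V : choiceType) (v1 v2 v3 v4 : V) (s : graph V)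
    (distinct_v : uniq [:: v1; v2; v3; v4])
    (s_avoids_v1 : forall e : edge V, e \in edges s -> v1 \notin vertices e) :
  graph_cnfs s \wedge graph_cnfs (graph1 (edge3 v1 v2 v3))
               \wedge graph_cnfs (graph1 (edge3 v1 v2 v4))
               \wedge graph_cnfs (graph1 (edge3 v1 v3 v4))
  \sim
  (graph_cnfs s \wedge graph_cnfs (graph1 (edge2 v2 v3))) `|`
  (graph_cnfs s \wedge graph_cnfs (graph1 (edge2 v2 v4))) `|`
  (graph_cnfs s \wedge graph_cnfs (graph1 (edge2 v3 v4))).
Proof.
set L := (L in L \sim _); set R := (R in _ \sim R).
suff LR : totally_satisfiable L <-> totally_satisfiable R.
  have [tL|uL] := boolp.EM (totally_satisfiable L); first by left; rewrite -LR.
  by right; rewrite /unsatisfiable -LR.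
split=> -[neq0 sat]; split.
- move: neq0; rewrite /L !and_graph1_neq0 => -[x sx].
  have [y Ry] : (graph_cnfs s \wedge graph_cnfs (graph1 (edge2 v2 v3))) !=set0.
    by apply/and_graph1_neq0; exists x.
  by exists y; left; left.
- have sat3 x : graph_cnfs s x ->
      forall b1 b2 b3, satisfiable (and_edges3 v1 v2 v3 v4 x b1 b2 b3).
    move=> sx b1 b2 b3; apply/sat/and_edges3P.
    by exists x => //; exists b1, b2, b3.
  move=> y [[]|] /and_graph1P[x sx [b ->]];
    by case: (satisfiable_resolvents distinct_v (sat3 x sx)).
- apply/and_graph1_neq0/and_graph1_neq0/and_graph1_neq0.
  by case: neq0 => y [[]|] /and_graph1P[x sx _]; exists x.
- move=> _ /and_edges3P[x sx [b1 [b2 [b3 ->]]]].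
  apply: (satisfiable_and_edges3 distinct_v s_avoids_v1 sx) => b; apply: sat.
  + by left; left; apply/and_graph1P; exists x => //; exists b.
  + by left; right; apply/and_graph1P; exists x => //; exists b.
  + by right; apply/and_graph1P; exists x => //; exists b.
Qed.
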